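(* Let $N>4$ be an integer, let $U$ be a binary quantic of order $N$ in $(p,q)$, and let $H,S,T$ be its normalized covariants as defined in the context. Then, as polynomials in $(p,q)$, $$(N-4)\,(U,H)\,S=(N-2)\,\big[(U,S)\,H-(U,T)\,U\big].$$
   Context: Work over $\mathbb{K}=\mathbb{R}$ or $\mathbb{C}$. A (binary) quantic of order $N$ is a homogeneous polynomial of degree $N$ in $(p,q)$, written $U=\sum_{n=0}^{N}\binom{N}{n}a_n p^{N-n}q^n$ with $a_n\in\mathbb{K}$. Subscripts $p,q$ denote partial derivatives. The Jacobian of two polynomials is $(X,Y)=X_pY_q-X_qY_p$. Normalized Hessian $H$: $U_{pp}U_{qq}-U_{pq}^2 = N^2(N-1)^2 H$. Covariants $S$ and $T$: put $A=U_{pppp}$, $B=U_{pppq}$, $C=U_{ppqq}$, $D=U_{pqqq}$, $E=U_{qqqq}$. Then $S$ and $T$ are defined by $$AE-4BD+3C^2=[N(N-1)(N-2)(N-3)]^2 S,$$ $$ACE+2BCD-AD^2-B^2E-C^3=[N(N-1)(N-2)(N-3)]^3 T.$$ *)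

(* Defs.v *)
From HB Require Import structures.
From mathcomp Require Import all_boot all_order all_algebra.
From mathcomp Require Import mpoly reals complex.

Set Implicit Arguments.
Unset Strict Implicit.
Unset Printing Implicit Defensive.

Import GRing.Theory Num.Theory.
Local Open Scope ring_scope.

(* A binary quantic of order N is an element
   U \is N.-homog of {mpoly K[2]}; lemma quanticP below gives its expansion
   with binomial coefficients.  The variables are p = 'X_0 and q = 'X_1. *)

Section Quantics.
Variable K : fieldType.
Implicit Types (U X Y : {mpoly K[2]}) (N : nat).

Definition dp U : {mpoly K[2]} := U^`M(0).
Definition dq U : {mpoly K[2]} := U^`M(1).

Definition jacobian X Y : {mpoly K[2]} := dp X * dq Y - dq X * dp Y.

(* The covariants are given by equations "expression = c * covariant"; over a
   field of characteristic 0 the scalar c is invertible once N >= 4, and the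
   lemmas hessianE, covSE and covTE below recover these equations.  The
   natural-number products N(N-1) and N(N-1)(N-2)(N-3) have the intended
   value for every N, truncated subtraction notwithstanding. *)

Definition hessian N U : {mpoly K[2]} :=
  ((N ^ 2 * (N - 1) ^ 2)%N%:R)^-1 *:
    (dp (dp U) * dq (dq U) - dq (dp U) ^+ 2).

Definition covS N U : {mpoly K[2]} :=
  let A := dp (dp (dp (dp U))) in
  let B := dq (dp (dp (dp U))) in
  let C := dq (dq (dp (dp U))) in
  let D := dq (dq (dq (dp U))) in
  let E := dq (dq (dq (dq U))) in
  (((N * (N - 1) * (N - 2) * (N - 3)) ^ 2)%N%:R)^-1 *:
    (A * E - 4 * B * D + 3 * C ^+ 2).

Definition covT N U : {mpoly K[2]} :=
  let A := dp (dp (dp (dp U))) in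
  let B := dq (dp (dp (dp U))) in
  let C := dq (dq (dp (dp U))) in
  let D := dq (dq (dq (dp U))) in
  let E := dq (dq (dq (dq U))) in
  (((N * (N - 1) * (N - 2) * (N - 3)) ^ 3)%N%:R)^-1 *:
    (A * C * E + 2 * B * C * D - A * D ^+ 2 - B ^+ 2 * E - C ^+ 3).

Hypothesis pcharK : [pchar K] =i pred0.

Let natrK_neq0 n : (0 < n)%N -> n%:R != 0 :> K.
Proof. by move: pcharK => /pcharf0P ->; rewrite lt0n. Qed.

Lemma quanticP N U :
  U \is N.-homog <->
  exists a : nat -> K,
    U = \sum_(n < N.+1) ('C(N, n)%:R * a n) *: ('X_0 ^+ (N - n) * 'X_1 ^+ n).
Proof.
pose mon (n : nat) : 'X_{1..2} := (U_(0%R) *+ (N - n) + U_(1%R) *+ n)%MM.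
have monE n : 'X_0 ^+ (N - n) * 'X_1 ^+ n = 'X_[mon n] :> {mpoly K[2]}.
  by rewrite !mpolyXn -mpolyXD.
have mon1 n : mon n 1%R = n.
  by rewrite /mon mnmDE !mulmnE !mnm1E /= mul0n mul1n add0n.
have mon_deg n : (n <= N)%N -> mdeg (mon n) = N.
  by move=> le_nN; rewrite mdegD !mdegMn !mdeg1 !mul1n subnK.
split=> [homU|[a ->]]; last first.
  apply: rpred_sum => i _; apply: rpredZ; rewrite monE dhomogX /=.
  by rewrite mon_deg // -ltnS.
exists (fun n => 'C(N, n)%:R^-1 * U@_(mon n)).
under eq_bigr => i _ do rewrite mulVKf ?natrK_neq0 ?bin_gt0 -1?ltnS // monE.
apply/mpolyP => m; rewrite raddf_sum /=.
under eq_bigr => i _ do rewrite mcoeffZ mcoeffX.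
have [dm|dm] := eqVneq (mdeg m) N; last first.
  rewrite (dhomog_nemf_coeff homU) // big1 // => i _.
  case: eqP => [e|_]; last by rewrite mulr0.
  by case/eqP: dm; rewrite -e mon_deg // -ltnS.
have dmE : (m 0%R + m 1%R = N)%N by rewrite -dm mdegE !big_ord_recl big_ord0 addn0; congr (_ + m _)%N; apply/val_inj.
have lt_mN : (m 1%R < N.+1)%N by rewrite ltnS -dmE leq_addl.
have mE : mon (m 1%R) = m.
  apply/mnmP => i; rewrite /mon mnmDE !mulmnE !mnm1E.
  case: i => [[|[|//]] lt_i2] /=; rewrite ?mul1n ?mul0n ?add0n ?addn0.
    by rewrite -dmE addnK; congr (m _); apply/val_inj.
  by congr (m _); apply/val_inj.
rewrite (bigD1 (Ordinal lt_mN)) //= mE eqxx mulr1 big1 ?addr0 // => i ne_i.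
case: eqP => [e|_]; last by rewrite mulr0.
by case/eqP: ne_i; apply/val_inj; rewrite /= -e mon1.
Qed.

Lemma hessianE N U : (1 < N)%N ->
  dp (dp U) * dq (dq U) - dq (dp U) ^+ 2
    = (N ^ 2 * (N - 1) ^ 2)%N%:R *: hessian N U.
Proof.
move=> N1; rewrite /hessian scalerA mulfV ?scale1r // natrK_neq0 //.
by rewrite muln_gt0 !expn_gt0 subn_gt0 N1 (ltnW N1).
Qed.

Let falling4_gt0 N k : (3 < N)%N ->
  (0 < (N * (N - 1) * (N - 2) * (N - 3)) ^ k)%N.
Proof. by case: N => [|[|[|[|N]]]] // _; rewrite expn_gt0 !subSS. Qed.

Lemma covSE N U : (3 < N)%N ->
  let A := dp (dp (dp (dp U))) in
  let B := dq (dp (dp (dp U))) in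
  let C := dq (dq (dp (dp U))) in
  let D := dq (dq (dq (dp U))) in
  let E := dq (dq (dq (dq U))) in
  A * E - 4 * B * D + 3 * C ^+ 2
    = ((N * (N - 1) * (N - 2) * (N - 3)) ^ 2)%N%:R *: covS N U.
Proof.
by move=> N3 /=; rewrite /covS scalerA mulfV ?scale1r // natrK_neq0 ?falling4_gt0.
Qed.

Lemma covTE N U : (3 < N)%N ->
  let A := dp (dp (dp (dp U))) in
  let B := dq (dp (dp (dp U))) in
  let C := dq (dq (dp (dp U))) in
  let D := dq (dq (dq (dp U))) in
  let E := dq (dq (dq (dq U))) in
  A * C * E + 2 * B * C * D - A * D ^+ 2 - B ^+ 2 * E - C ^+ 3
    = ((N * (N - 1) * (N - 2) * (N - 3)) ^ 3)%N%:R *: covT N U.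
Proof.
by move=> N3 /=; rewrite /covT scalerA mulfV ?scale1r // natrK_neq0 ?falling4_gt0.
Qed.

End Quantics.

Lemma pchar_real_or_complex (R : realType) (K : fieldType) :
  K = R :> fieldType \/ K = R[i] :> fieldType -> [pchar K] =i pred0.
Proof. by case=> ->; apply: pchar_num. Qed.

(* Main.v *)
Require Import Defs.
From HB Require Import structures.
From mathcomp Require Import all_boot all_order all_algebra.
From mathcomp Require Import mpoly reals complex.
From mathcomp Require Import ring.

Local Open Scope ring_scope.
Import GRing.Theory.

(** Write [(U, X)] for the Jacobian.  For fixed [U] the map [X |-> (U, X)] is a
    derivation that kills [U], and everything follows from applying it to the
    classical covariants of a quartic.

    By Euler's theorem the partial derivatives of [U] of order at most 4,
    divided by the falling factorials of [N], satisfy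
    [x_ij = p x_(i+1)j + q x_i(j+1)], as if [U] were the binary quartic in
    [p, q] with coefficients its own fourth derivatives.  Hence [U], [H], [S],
    [T] and the sextic covariant [G], with [(U, H) = N (N-2) G], obey the
    syzygy of the covariants of a quartic
[[
      G^2 = S H U^2 - T U^3 - 4 H^3                      (quartic_syzygy).
]]
    Applying [(U, _)] to it gives
[[
      U^2 [(U,S) H - (U,T) U] = 2 G (U,G) + (12 H^2 - S U^2) (U,H)
                                                         (der_syzygy),
]]
    and [(U, G)] only involves fourth derivatives of [U] again, namely
[[
      (U, G) = N [(N-3) U^2 S - 6 (N-2) H^2]             (der_sextic).
]]
    After substitution of [G = (U,H) / (N (N-2))] the terms in [H^2] cancel,
    and what is left is [U^2] times the relation to be proved.  No fifth derivative is ever expanded.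

    Both the syzygy and the formula for [(U, G)] are checked where they have
    their shortest form: multiplying a covariant by a suitable power of [p]
    turns it into the same expression in [x_00, ..., x_04] that one gets from
    the coefficients by setting [p = 1], [q = 0].  That is invariance under
    the shear that moves the point [(p, q)] to [(p, 0)]. *)

(** * Covariants of a binary quartic and their syzygy *)

Section QuarticForms.
Set Implicit Arguments.
Unset Strict Implicit.
Variable R : comNzRingType.
Implicit Types (p q : R) (x : nat -> nat -> R).

(** Below, [x i j] stands for the derivative of a form, [i] times along [p] and
    [j] times along [q], scaled so that the [x i j] with [i + j = 4] are the
    coefficients [a, b, c, d, e] of a quartic with binomial factors. *)
Definition hess_form x : R := x 2 0 * x 0 2 - x 1 1 ^+ 2.

Definition S_form x : R :=
  x 4 0 * x 0 4 - 4 * x 3 1 * x 1 3 + 3 * x 2 2 ^+ 2.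

Definition T_form x : R :=
  x 4 0 * x 2 2 * x 0 4 + 2 * x 3 1 * x 2 2 * x 1 3
    - x 4 0 * x 1 3 ^+ 2 - x 3 1 ^+ 2 * x 0 4 - x 2 2 ^+ 3.

(** The Jacobian of the form and its Hessian, without the numerical factor; at
    [p = 1], [q = 0] it is [a^2 d - 3 a b c + 2 b^3]. *)
Definition sextic_form x : R :=
  x 1 0 * (x 2 1 * x 0 2 + x 2 0 * x 0 3 - 2 * x 1 1 * x 1 2)
    - x 0 1 * (x 3 0 * x 0 2 + x 2 0 * x 1 2 - 2 * x 1 1 * x 2 1).

(** Euler's relations for the scaled derivatives. They express every entry
    through the five entries of order 4, so that an identity between entries
    becomes a polynomial identity in [p, q, a, b, c, d, e]. *)
Definition polar_tower p q x : Prop :=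
  forall i j, (i + j < 4)%N -> x i j = p * x i.+1 j + q * x i j.+1.

Lemma polar_towerE p q x : polar_tower p q x ->
  [/\ x 3 0 = p * x 4 0 + q * x 3 1, x 2 1 = p * x 3 1 + q * x 2 2,
      x 1 2 = p * x 2 2 + q * x 1 3 & x 0 3 = p * x 1 3 + q * x 0 4]
  /\ [/\ x 2 0 = p * x 3 0 + q * x 2 1, x 1 1 = p * x 2 1 + q * x 1 2,
         x 0 2 = p * x 1 2 + q * x 0 3, x 1 0 = p * x 2 0 + q * x 1 1 &
         x 0 1 = p * x 1 1 + q * x 0 2]
  /\ x 0 0 = p * x 1 0 + q * x 0 1.
Proof. by move=> tower; do !split; apply: tower. Qed.

(** This lemma and the next three rest on [p x_(i+1)j = x_ij - q x_i(j+1)],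
    which removes the derivatives along [p] at the cost of one factor [p] each;
    [q] then drops out because the forms are invariant under the shear. *)
Lemma hess_form_shear p q x : polar_tower p q x ->
  p ^+ 2 * hess_form x = x 0 0 * x 0 2 - x 0 1 ^+ 2.
Proof.
case/polar_towerE => -[x30 x21 x12 x03] [[x20 x11 x02 x10 x01] x00].
by rewrite /hess_form x00 x10 x01 x20 x11; ring.
Qed.

Lemma S_form_shear p q x : polar_tower p q x ->
  p ^+ 4 * S_form x = x 0 0 * x 0 4 - 4 * x 0 1 * x 0 3 + 3 * x 0 2 ^+ 2.
Proof.
case/polar_towerE => -[x30 x21 x12 x03] [[x20 x11 x02 x10 x01] x00].
by rewrite /S_form x00 x10 x01 x20 x11 x02 x30 x21 x12 x03; ring.
Qed.

Lemma T_form_shear p q x : polar_tower p q x ->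
  p ^+ 6 * T_form x =
    x 0 0 * x 0 2 * x 0 4 + 2 * x 0 1 * x 0 2 * x 0 3
      - x 0 0 * x 0 3 ^+ 2 - x 0 1 ^+ 2 * x 0 4 - x 0 2 ^+ 3.
Proof.
case/polar_towerE => -[x30 x21 x12 x03] [[x20 x11 x02 x10 x01] x00].
by rewrite /T_form x00 x10 x01 x20 x11 x02 x30 x21 x12 x03; ring.
Qed.

Lemma sextic_form_shear p q x : polar_tower p q x ->
  p ^+ 3 * sextic_form x =
    x 0 0 ^+ 2 * x 0 3 - 3 * x 0 0 * x 0 1 * x 0 2 + 2 * x 0 1 ^+ 3.
Proof.
case/polar_towerE => -[x30 x21 x12 x03] [[x20 x11 x02 x10 x01] x00].
by rewrite /sextic_form x00 x10 x01 x20 x11 x02 x30 x21; ring.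
Qed.

End QuarticForms.

(** After multiplication by [p^6] this is the elementary syzygy between the
    seminvariants of a quartic, an identity in [x_00, ..., x_04] alone. *)
Lemma quartic_syzygy (R : idomainType) (p q : R) (x : nat -> nat -> R) :
  p != 0 -> polar_tower p q x ->
  sextic_form x ^+ 2 =
    S_form x * hess_form x * x 0 0 ^+ 2 - T_form x * x 0 0 ^+ 3
      - 4 * hess_form x ^+ 3.
Proof.
move=> p_neq0 tower; apply: (mulfI (expf_neq0 6 p_neq0)).
have g := sextic_form_shear tower; have h := hess_form_shear tower.
have s := S_form_shear tower; have t := T_form_shear tower.
transitivity ((p ^+ 3 * sextic_form x) ^+ 2); first by ring.
transitivity ((p ^+ 4 * S_form x) * (p ^+ 2 * hess_form x) * x 0 0 ^+ 2
  - (p ^+ 6 * T_form x) * x 0 0 ^+ 3 - 4 * (p ^+ 2 * hess_form x) ^+ 3).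
  by rewrite g h s t; ring.
by ring.
Qed.

(** * Differentiating the syzygy along the form *)

Section JacobianDerivation.
Set Implicit Arguments.
Unset Strict Implicit.

(** The derivation [D] is [(U, _)] and [x] the scaled derivatives of [U], but
    kept abstract: here the entries of [x] are mere symbols for [ring]. *)
Variables (R : idomainType) (D : R -> R).
Hypothesis derB : {morph D : f g / f - g}.
Hypothesis derM : forall f g, D (f * g) = D f * g + f * D g.

Let der0 : D 0 = 0.
Proof. by have := derB 0 0; rewrite !subrr. Qed.

Let derD : {morph D : f g / f + g}.
Proof.
move=> f g; have derN h : D (- h) = - D h by rewrite -sub0r derB der0 sub0r.
by rewrite -[g in LHS]opprK derB derN opprK.
Qed.

Let der_natl m f : D (m%:R * f) = m%:R * D f.
Proof.
by rewrite !mulr_natl; elim: m => [|m IHm]; rewrite ?mulr0n // !mulrS derD IHm.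
Qed.

Let derE := (derB, derD, der_natl, derM).

(** As [D u = 0], the terms of the differentiated syzygy that contain [D s] or
    [D t] keep the factor [u^2]; moved to the other side, [s h u^2] and [4 h^3]
    account for the multiple of [D h]. *)
Lemma der_syzygy u h s t g : D u = 0 ->
    g ^+ 2 = s * h * u ^+ 2 - t * u ^+ 3 - 4 * h ^+ 3 ->
  u ^+ 2 * (D s * h - D t * u) =
    2 * g * D g + (12 * h ^+ 2 - s * u ^+ 2) * D h.
Proof.
move=> du /(congr1 D); rewrite !exprS !expr0 !mulr1 -!mulrA !derE du => dsyz.
apply: (addIr (s * u ^+ 2 * D h - 12 * h ^+ 2 * D h)).
by apply: (etrans _ (etrans (esym dsyz) _)); ring.
Qed.

Variables (p q n : R) (x : nat -> nat -> R).
Hypothesis p_neq0 : p != 0.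
Hypothesis tower : polar_tower p q x.
Hypothesis der_p : D p = - (n * x 0 1).
Hypothesis der_x00 : D (x 0 0) = 0.
Hypothesis der_x : forall i j, (i + j < 4)%N ->
  D (x i j) = n * (n - (i + j)%N%:R) * (x 1 0 * x i j.+1 - x 0 1 * x i.+1 j).

Lemma der_hess : D (hess_form x) = n * (n - 2) * sextic_form x.
Proof. by rewrite /hess_form expr2 !derE !der_x // /sextic_form; ring. Qed.

(** After multiplication by [p] the derivation acts on [x_00, ..., x_04] without
    leaving this list; this is what makes the shear useful for [der_sextic]. *)
Lemma p_der_x0 j : (j < 4)%N ->
  p * D (x 0 j) = n * (n - j%:R) * (x 0 0 * x 0 j.+1 - x 0 1 * x 0 j).
Proof.
move=> ltj4; rewrite der_x // add0n (@tower 0 0)%N // (@tower 0 j)%N //.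
by ring.
Qed.

(** Apply [D] to [p^3 g = x_00^2 x_03 - 3 x_00 x_01 x_02 + 2 x_01^3] and
    multiply by [p]; the right-hand side is then computed by [p_der_x0] and is
    recognised as a combination of the sheared [u^2 s] and [h^2]. *)
Lemma der_sextic :
  D (sextic_form x) =
    n * ((n - 3) * x 0 0 ^+ 2 * S_form x - 6 * (n - 2) * hess_form x ^+ 2).
Proof.
have := sextic_form_shear tower; have := hess_form_shear tower.
have := S_form_shear tower.
move: (sextic_form x) (hess_form x) (S_form x) => G H S s h g.
have /= := congr1 (fun f => p * D f) g.
rewrite !exprS !expr0 !mulr1 -!mulrA !derE der_x00 der_p => dg.
apply: (mulfI (expf_neq0 4 p_neq0)).
(* The first summand compensates for the derivative of the factor p^3. *)
transitivity (3 * n * x 0 1 * (p ^+ 3 * G) +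
    (x 0 0 ^+ 2 * (p * D (x 0 3)) - 3 * x 0 0 * (p * D (x 0 1)) * x 0 2
      - 3 * x 0 0 * x 0 1 * (p * D (x 0 2))
      + 6 * x 0 1 ^+ 2 * (p * D (x 0 1)))).
  apply: (addIr (- (3 * n * x 0 1 * (p ^+ 3 * G)))).
  by apply: (etrans _ (etrans dg _)); ring.
transitivity (n * ((n - 3) * x 0 0 ^+ 2 * (p ^+ 4 * S)
    - 6 * (n - 2) * (p ^+ 2 * H) ^+ 2)); last by ring.
by rewrite !p_der_x0 // g s h; ring.
Qed.

(** Since [D h] is a multiple of the sextic covariant [g], so is the whole
    right-hand side of [der_syzygy], and [(n-2)] times it is
    [2 D h ((n-3) u^2 s - 6 (n-2) h^2) + (n-2) (12 h^2 - s u^2) D h].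
    The terms in [h^2] cancel and [2 (n-3) - (n-2) = n-4] remains as the
    coefficient of [s u^2 D h]. *)
Lemma der_relation : x 0 0 != 0 ->
  (n - 4) * (D (hess_form x) * S_form x) =
  (n - 2) * (D (S_form x) * hess_form x - D (T_form x) * x 0 0).
Proof.
move=> x00_neq0.
have dsyz := der_syzygy der_x00 (quartic_syzygy p_neq0 tower).
apply: (mulfI (expf_neq0 2 x00_neq0)).
by rewrite [RHS]mulrCA dsyz der_sextic der_hess; ring.
Qed.

End JacobianDerivation.

(** * Scaled derivatives of a binary form *)

(** Euler's theorem on homogeneous functions: on the monomial [X^m] the operator
    [X_i d/dX_i] is multiplication by [m i]. *)
Lemma euler_homog (R : comNzRingType) (n d : nat) (U : {mpoly R[n]}) :
  U \is d.-homog -> \sum_(i < n) 'X_i * U^`M(i) = d%:R *: U.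
Proof.
move=> homU; rewrite [in LHS](mpolyE U) [in RHS](mpolyE U) scaler_sumr.
under eq_bigr => i _ do rewrite (raddf_sum (mderiv i)) mulr_sumr.
rewrite exchange_big big_seq [RHS]big_seq; apply: eq_bigr => m m_supp /=.
have termE i : 'X_i * (U@_m *: 'X_[m])^`M(i) = U@_m *: ('X_[m] *+ m i).
  rewrite mderivZ mderivX -!scalerAr scaler_nat -mpolyXD addmC.
  have [->|mi_gt0] := posnP (m i); first by rewrite !mulr0n.
  by rewrite submK // lep1mP -lt0n.
under eq_bigr => i _ do rewrite termE.
rewrite -scaler_sumr sumrMnr -mdegE (dhomog_mf homU m_supp).
by rewrite scaler_nat scalerMnr.
Qed.

Section BinaryForms.
Set Implicit Arguments.
Unset Strict Implicit.
Variable K : fieldType.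
Implicit Types (U X Y : {mpoly K[2]}) (N m i j k : nat).

Lemma dpM X Y : dp (X * Y) = dp X * Y + X * dp Y.
Proof. exact: mderivM. Qed.

Lemma dqM X Y : dq (X * Y) = dq X * Y + X * dq Y.
Proof. exact: mderivM. Qed.

Lemma dqdpC X : dq (dp X) = dp (dq X).
Proof. exact: mderiv_comm. Qed.

Lemma dp_natl m X : dp (m%:R * X) = m%:R * dp X.
Proof. by rewrite !mulr_natl; apply: mderivMn. Qed.

Lemma dq_natl m X : dq (m%:R * X) = m%:R * dq X.
Proof. by rewrite !mulr_natl; apply: mderivMn. Qed.

Lemma submm n (m : 'X_{1..n}) : (m - m)%MM = 0%MM.
Proof. by apply/mnmP => i; rewrite mnmBE subnn mnm0E. Qed.

Lemma dpX0 : dp ('X_0 : {mpoly K[2]}) = 1.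
Proof. by rewrite /dp mderivX mnm1E /= scale1r submm mpolyX0. Qed.

Lemma dpX1 : dp ('X_1 : {mpoly K[2]}) = 0.
Proof. by rewrite /dp mderivX mnm1E /= scale0r. Qed.

Lemma X0_neq0 : ('X_0 : {mpoly K[2]}) != 0.
Proof.
apply/eqP => X0_eq0; have /eqP := dpX0.
by rewrite X0_eq0 /dp mderiv0 eq_sym oner_eq0.
Qed.

Lemma dqX0 : dq ('X_0 : {mpoly K[2]}) = 0.
Proof. by rewrite /dq mderivX mnm1E /= scale0r. Qed.

Lemma dqX1 : dq ('X_1 : {mpoly K[2]}) = 1.
Proof. by rewrite /dq mderivX mnm1E /= scale1r submm mpolyX0. Qed.

Definition euler_op X : {mpoly K[2]} := 'X_0 * dp X + 'X_1 * dq X.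

Lemma euler_op_homog N U : U \is N.-homog -> euler_op U = N%:R * U.
Proof.
move=> homU; rewrite -mpolyC_nat mul_mpolyC -euler_homog // /euler_op.
rewrite big_ord_recl big_ord1 /dp /dq.
by congr (_ * _^`M(_) + 'X__ * _^`M(_)); apply: val_inj.
Qed.

(** Differentiate Euler's relation; the product rule contributes one copy of
    [dp X], which lowers the eigenvalue by one. *)
Lemma euler_op_dp m X :
  euler_op X = m.+1%:R * X -> euler_op (dp X) = m%:R * dp X.
Proof.
move=> /(congr1 (@dp K)); rewrite dp_natl -natr1 /euler_op [dp (_ + _)]mderivD.
rewrite -!/(dp _) !dpM dpX0 dpX1 dqdpC => eq_dp.
apply: (addrI (dp X)); apply: (etrans _ (etrans eq_dp _)); ring.
Qed.

Lemma euler_op_dq m X :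
  euler_op X = m.+1%:R * X -> euler_op (dq X) = m%:R * dq X.
Proof.
move=> /(congr1 (@dq K)); rewrite dq_natl -natr1 /euler_op [dq (_ + _)]mderivD.
rewrite -!/(dq _) !dqM dqX0 dqX1 dqdpC => eq_dq.
apply: (addrI (dq X)); apply: (etrans _ (etrans eq_dq _)); ring.
Qed.

Lemma euler_op_iter (d : {mpoly K[2]} -> {mpoly K[2]}) :
    (forall m X, euler_op X = m.+1%:R * X -> euler_op (d X) = m%:R * d X) ->
  forall k m X, euler_op X = (m + k)%N%:R * X ->
    euler_op (iter k d X) = m%:R * iter k d X.
Proof.
move=> step; elim=> [|k IHk] m X; first by rewrite addn0.
by rewrite -addSnnS => /IHk /step.
Qed.

Hypothesis pcharK : [pchar K] =i pred0.

Lemma natr_neq0 m : (0 < m)%N -> m%:R != 0 :> K.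
Proof. by move: pcharK => /pcharf0P ->; rewrite lt0n. Qed.

(** With the falling factorial as denominator, Euler's relations lose their
    numerical factor and the covariants of [U] lose theirs. *)
Definition nder N U i j : {mpoly K[2]} :=
  ((N ^_ (i + j))%N%:R)^-1 *: iter j (@dq K) (iter i (@dp K) U).

Lemma dq_nder N U i j : (i + j < N)%N ->
  dq (nder N U i j) = (N - (i + j))%N%:R * nder N U i j.+1.
Proof.
move=> ltijN; rewrite /nder /dq mderivZ -mpolyC_nat mul_mpolyC scalerA addnS.
congr (_ *: _); rewrite ffactnSr natrM invfM mulrCA mulfV ?mulr1 //.
by rewrite natr_neq0 // subn_gt0.
Qed.

Lemma dp_nder N U i j : (i + j < N)%N ->
  dp (nder N U i j) = (N - (i + j))%N%:R * nder N U i.+1 j.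
Proof.
move=> ltijN; rewrite /nder /dp mderivZ -mpolyC_nat mul_mpolyC scalerA addSn.
have -> : (iter j (@dq K) (iter i (@dp K) U))^`M(0) =
    iter j (@dq K) (iter i.+1 (@dp K) U).
  by elim: j {ltijN} => //= j IHj; rewrite -/(dp _) -dqdpC -IHj.
congr (_ *: _); rewrite ffactnSr natrM invfM mulrCA mulfV ?mulr1 //.
by rewrite natr_neq0 // subn_gt0.
Qed.

Lemma euler_nder N U i j : U \is N.-homog -> (i + j < N)%N ->
  nder N U i j = 'X_0 * nder N U i.+1 j + 'X_1 * nder N U i j.+1.
Proof.
move=> homU ltijN.
pose l := (N - (i + j))%N.
have eulU : euler_op U = (l + j + i)%N%:R * U.
  by rewrite -addnA (addnC j) (subnK (ltnW ltijN)); apply: euler_op_homog.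
have eul := euler_op_iter euler_op_dq (euler_op_iter euler_op_dp eulU).
have l_neq0 : l%:R != 0 :> {mpoly K[2]}.
  by rewrite -mpolyC_nat mpolyC_eq0 natr_neq0 // subn_gt0.
apply: (mulfI l_neq0).
rewrite mulrDr mulrCA [X in _ + X]mulrCA -dp_nder // -dq_nder //.
rewrite /nder /dp /dq !mderivZ -!scalerAr -scalerDr.
by congr (_ *: _).
Qed.

Lemma deriv_nder N U i j : (i + j <= N)%N ->
  iter j (@dq K) (iter i (@dp K) U) = (N ^_ (i + j))%N%:R * nder N U i j.
Proof.
move=> leijN; rewrite /nder -mpolyC_nat mul_mpolyC scalerA mulfV ?scale1r //.
by rewrite natr_neq0 // ffact_gt0.
Qed.

Lemma scale_natV m X Y : (0 < m)%N -> X = m%:R * Y -> (m%:R : K)^-1 *: X = Y.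
Proof.
move=> m_gt0 ->; rewrite -mpolyC_nat mul_mpolyC scalerA.
by rewrite mulVf ?scale1r ?natr_neq0.
Qed.

Lemma hessian_nder N U : (1 < N)%N ->
  hessian N U = hess_form (nder N U).
Proof.
move=> N_gt1; have D i j := @deriv_nder N U i j.
have D20 : dp (dp U) = (N ^_ 2)%N%:R * nder N U 2 0 by apply: (D 2 0)%N.
have D11 : dq (dp U) = (N ^_ 2)%N%:R * nder N U 1 1 by apply: (D 1 1)%N.
have D02 : dq (dq U) = (N ^_ 2)%N%:R * nder N U 0 2 by apply: (D 0 2)%N.
rewrite /hessian D20 D11 D02 -expnMn.
have -> : (N * (N - 1) = N ^_ 2)%N by rewrite !ffactnSr ffactn0 mul1n subn0.
apply: scale_natV; first by rewrite expn_gt0 ffact_gt0 N_gt1.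
by rewrite natrX /hess_form; move: (N ^_ 2)%N (nder N U) => f x; ring.
Qed.

Lemma deriv4_nder N U : (3 < N)%N ->
  [/\ dp (dp (dp (dp U))) = (N ^_ 4)%N%:R * nder N U 4 0,
      dq (dp (dp (dp U))) = (N ^_ 4)%N%:R * nder N U 3 1,
      dq (dq (dp (dp U))) = (N ^_ 4)%N%:R * nder N U 2 2,
      dq (dq (dq (dp U))) = (N ^_ 4)%N%:R * nder N U 1 3 &
      dq (dq (dq (dq U))) = (N ^_ 4)%N%:R * nder N U 0 4].
Proof.
move=> N_gt3; have D i j := @deriv_nder N U i j.
split; [exact: (D 4 0)%N | exact: (D 3 1)%N | exact: (D 2 2)%N
       | exact: (D 1 3)%N | exact: (D 0 4)%N].
Qed.

Lemma covS_nder N U : (3 < N)%N -> covS N U = S_form (nder N U).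
Proof.
move=> N_gt3; rewrite /covS.
have [-> -> -> -> ->] := deriv4_nder U N_gt3.
have -> : (N * (N - 1) * (N - 2) * (N - 3) = N ^_ 4)%N.
  by rewrite !ffactnSr ffactn0 mul1n subn0.
apply: scale_natV; first by rewrite expn_gt0 ffact_gt0 N_gt3.
by rewrite natrX /S_form; move: (N ^_ 4)%N (nder N U) => f x; ring.
Qed.

Lemma covT_nder N U : (3 < N)%N -> covT N U = T_form (nder N U).
Proof.
move=> N_gt3; rewrite /covT.
have [-> -> -> -> ->] := deriv4_nder U N_gt3.
have -> : (N * (N - 1) * (N - 2) * (N - 3) = N ^_ 4)%N.
  by rewrite !ffactnSr ffactn0 mul1n subn0.
apply: scale_natV; first by rewrite expn_gt0 ffact_gt0 N_gt3.
by rewrite natrX /T_form; move: (N ^_ 4)%N (nder N U) => f x; ring.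
Qed.

(** * The relation for binary forms *)

Lemma jacobianM U X Y :
  jacobian U (X * Y) = jacobian U X * Y + X * jacobian U Y.
Proof. by rewrite /jacobian dpM dqM; ring. Qed.

Lemma jacobianB U X Y : jacobian U (X - Y) = jacobian U X - jacobian U Y.
Proof. by rewrite /jacobian /dp /dq !mderivB; ring. Qed.

Lemma jacobianXX U : jacobian U U = 0.
Proof. by rewrite /jacobian; ring. Qed.

Lemma jacobian0 X : jacobian 0 X = 0.
Proof. by rewrite /jacobian /dp /dq !mderiv0 !mul0r subrr. Qed.

Lemma nder00 N U : nder N U 0 0 = U.
Proof. by rewrite /nder ffactn0 invr1 scale1r. Qed.

Lemma polar_tower_nder N U : U \is N.-homog -> (3 < N)%N ->
  polar_tower 'X_0 'X_1 (nder N U).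
Proof.
by move=> homU N_gt3 i j ltij4; apply: euler_nder => //; apply: leq_trans N_gt3.
Qed.

Lemma jacobian_nder N U i j : (i + j < N)%N ->
  jacobian U (nder N U i j) = N%:R * (N%:R - (i + j)%N%:R) *
    (nder N U 1 0 * nder N U i j.+1 - nder N U 0 1 * nder N U i.+1 j).
Proof.
move=> ltijN; have N_gt0 : (0 < N)%N by apply: leq_ltn_trans ltijN.
rewrite /jacobian dp_nder // dq_nder //.
rewrite -{1 3}(nder00 N U) dp_nder // dq_nder //.
by rewrite subn0 natrB 1?ltnW //; ring.
Qed.

Lemma jacobian_X0 N U : (0 < N)%N -> jacobian U 'X_0 = - (N%:R * nder N U 0 1).
Proof.
move=> N_gt0; rewrite /jacobian dpX0 dqX0 -[in dq U](nder00 N U) dq_nder //.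
by rewrite addn0 subn0; ring.
Qed.

(** [der_relation] for the derivation [(U, _)]; the case [U = 0] is apart
    because that lemma cancels [U^2]. *)
Theorem jacobian_relation N U : (4 < N)%N -> U \is N.-homog ->
  let H := hessian N U in
  let S := covS N U in
  let T := covT N U in
  (N - 4)%N%:R *: (jacobian U H * S) =
  (N - 2)%N%:R *: (jacobian U S * H - jacobian U T * U).
Proof.
move=> N_gt4 homU; have N_gt3 := ltnW N_gt4; cbv zeta.
have [->|U_neq0] := eqVneq U 0.
  by rewrite !jacobian0 !mul0r subrr !scaler0.
have N_gt2 := ltnW N_gt3; have N_gt1 := ltnW N_gt2.
rewrite hessian_nder // covS_nder // covT_nder //.
rewrite -!mul_mpolyC !mpolyC_nat !natrB //.
have x00 := nder00 N U.
have dx00 : jacobian U (nder N U 0 0) = 0 by rewrite x00 jacobianXX.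
have dX0 := jacobian_X0 U (ltnW N_gt1).
have dx i j (ltij4 : (i + j < 4)%N) := jacobian_nder U (ltn_trans ltij4 N_gt4).
have := der_relation (jacobianB U) (jacobianM U) X0_neq0
  (polar_tower_nder homU N_gt3) dX0 dx00 dx.
by rewrite x00; apply.
Qed.

End BinaryForms.

Theorem theorem5 (R : realType) (K : fieldType)
    (hK : K = R :> fieldType \/ K = R[i] :> fieldType)
    (N : nat) (hN : (4 < N)%N) (U : {mpoly K[2]}) (hU : U \is N.-homog) :
  let H := hessian N U in
  let S := covS N U in
  let T := covT N U in
  (N - 4)%N%:R *: (jacobian U H * S) =
  (N - 2)%N%:R *: (jacobian U S * H - jacobian U T * U).
Proof.
by apply: jacobian_relation; first exact: (pchar_real_or_complex hK).
Qed.
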